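(* Let $d\geq 2$ be an integer. The locus of post-critically finite maps in $\mathcal{P}_d$ is contained in a countable union of $0$-dimensional subvarieties of $\mathcal{P}_d$ defined over $\mathbb{Q}$. In particular, if $f\in\mathcal{P}_d(\mathbb{C})$ is a post-critically finite class, then $f\in\mathcal{P}_d(\overline{\mathbb{Q}})$.
   Context: $\mathcal{P}_d$ is the moduli space of polynomials of degree $d$ up to affine conjugacy $f\sim\psi^{-1}\circ f\circ\psi$, $\psi(z)=\alpha z+\gamma$, $\alpha\neq 0$. For an algebraically closed field $K$ of characteristic $0$, $\mathcal{P}_d(K)$ is the set of affine conjugacy classes over $K$ of degree $d$ polynomials in $K[z]$. Every class contains a monic centred polynomial $z^d+a_{d-2}z^{d-2}+\cdots+a_0$, unique up to conjugation by $z\mapsto\zeta z$ with $\zeta^{d-1}=1$, so $\mathcal{P}_d$ is the quotient (a variety over $\mathbb{Q}$) of the affine space $\mathbb{A}^{d-1}$ with coordinates $(a_{d-2},\dots,a_0)$ by this action of the group of $(d-1)$-th roots of unity. A class $f\in\mathcal{P}_d(\mathbb{C})$ lies in $\mathcal{P}_d(\overline{\mathbb{Q}})$ if it contains a polynomial with coefficients in $\overline{\mathbb{Q}}$. A polynomial is post-critically finite if the forward orbit under iteration of each of its critical points is finite; this property depends only on the conjugacy class. *)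

(* Defs.v *)
(* Built on MathComp, with the sets of mathcomp-classical, the complex numbers
   of mathcomp-real-closed and the multivariate polynomials of multinomials. *)
From HB Require Import structures.
From mathcomp Require Import all_boot all_order all_algebra all_field.
From mathcomp Require Import ring_quotient boolp classical_sets cardinality reals complex.
From mathcomp Require Import mpoly.

Set Implicit Arguments.
Unset Strict Implicit.
Unset Printing Implicit Defensive.

Import GRing.Theory.
Local Open Scope ring_scope.
Local Open Scope classical_set_scope.

(* [psi^-1 \o f \o psi] for [psi z = alpha * z + gamma]. *)
Definition affine_conj (K : fieldType) (alpha gamma : K) (f : {poly K}) :
    {poly K} :=
  alpha^-1 *: (f \Po (alpha *: 'X + gamma%:P) - gamma%:P).

Definition conj_class (K : fieldType) (f : {poly K}) : set {poly K} :=
  [set g | exists alpha gamma : K, alpha != 0 /\ g = affine_conj alpha gamma f].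

(* The points of P_d over K; a point is the set of polynomials forming
   the conjugacy class. *)
Definition moduli (d : nat) (K : fieldType) : Type :=
  {c : set {poly K} | exists2 f : {poly K}, size f = d.+1 & c = conj_class f}.

Definition pcf (K : fieldType) (f : {poly K}) : Prop :=
  forall c : K, root f^`() c ->
    finite_set (range (fun n : nat => iter n (horner f) c)).

Definition pcf_class (d : nat) (K : fieldType) (c : moduli d K) : Prop :=
  exists2 f, sval c f & pcf f.

(* Conjugating 'X^d + \sum_(i < d.-1) a_i *: 'X^i by z |-> zeta * z, with
   zeta ^+ d.-1 = 1, multiplies the coordinate a_i by zeta ^ (i - 1). *)
Definition root1_act (d : nat) (zeta : algC) :
    (d.-1).-tuple {mpoly algC[d.-1]} :=
  [tuple (zeta ^+ i / zeta) *: 'X_i | i < d.-1].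

(* The group scheme of (d-1)-th roots of unity is defined over Q but its
   points are not, so invariance of P is tested over the algebraic numbers. *)
Definition root1_invariant (d : nat) : {pred {mpoly rat[d.-1]}} :=
  fun P => `[< forall zeta : algC, zeta ^+ d.-1 = 1 ->
    map_mpoly ratr P \mPo root1_act d zeta = map_mpoly ratr P >].
Arguments root1_invariant : clear implicits.

Lemma root1_invariant_subring d : subring_closed (root1_invariant d).
Proof.
split=> [|P Q /asboolP HP /asboolP HQ|P Q /asboolP HP /asboolP HQ];
  apply/asboolP=> z hz.
- by rewrite !rmorph1.
- by rewrite !rmorphB /= HP ?HQ.
- by rewrite !rmorphM /= HP ?HQ.
Qed.

HB.instance Definition _ d := GRing.isSubringClosed.Build
  {mpoly rat[d.-1]} (root1_invariant d) (root1_invariant_subring d).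

(* The coordinate ring Q[P_d] of P_d, the quotient of the affine space with
   coordinates a_0, ..., a_(d-2) by the (d-1)-th roots of unity. *)
Record coord_ring (d : nat) := CoordRing {
  coord_val :> {mpoly rat[d.-1]};
  _ : coord_val \in root1_invariant d }.

HB.instance Definition _ d := [isSub for @coord_val d].
HB.instance Definition _ d := [Choice of coord_ring d by <:].
HB.instance Definition _ d := [SubChoice_isSubComNzRing of coord_ring d by <:].

(* A nonempty closed subvariety of P_d defined over Q, possibly reducible,
   given by its vanishing ideal in Q[P_d] (idealr_closed requires the ideal to
   be proper). *)
Record subvariety (d : nat) := Subvariety {
  sv_ideal : {pred coord_ring d};
  sv_idealP : idealr_closed sv_ideal;
  sv_radicalP : forall (P : coord_ring d) (n : nat),
    P ^+ n \in sv_ideal -> P \in sv_ideal }.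

(* The K-point c lies on V: the ideal of V vanishes at the coordinates of
   some (equivalently, by invariance, any) monic centred representative of c. *)
Definition on_subvariety (d : nat) (K : fieldType) (V : subvariety d)
    (c : moduli d K) : Prop :=
  exists f : {poly K}, [/\ sval c f, f \is monic, f`_d.-1 = 0 &
    forall P : coord_ring d, P \in sv_ideal V ->
      (map_mpoly ratr (coord_val P)).@[fun i : 'I_d.-1 => f`_i] = 0].

Definition prime_ideal (A : comNzRingType) (p : {pred A}) : Prop :=
  idealr_closed p /\ prime_idealr_closed p.

Definition prime_chain (A : comNzRingType) (I : {pred A}) (n : nat) : Prop :=
  exists p : nat -> {pred A},
    (forall i, (i <= n)%N -> prime_ideal (p i) /\ {subset I <= p i}) /\
    (forall i, (i < n)%N ->
      {subset p i <= p i.+1} /\ ~ {subset p i.+1 <= p i}).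

(* The dimension of V is the Krull dimension of Q[V] = Q[P_d] / I(V), whose
   primes are those of Q[P_d] containing I(V). *)
Definition has_dim (d : nat) (V : subvariety d) (n : nat) : Prop :=
  prime_chain (sv_ideal V) n /\ ~ prime_chain (sv_ideal V) n.+1.

Definition defined_over_Qbar (d : nat) (K : fieldType) (c : moduli d K) :
    Prop :=
  exists2 f, sval c f & forall i : nat, algebraicOver (@ratr K) f`_i.

(* Main.v *)
Require Import Defs.
From HB Require Import structures.
From mathcomp Require Import all_boot all_order all_algebra all_field.
From mathcomp Require Import generic_quotient ring_quotient fraction.
From mathcomp Require Import boolp classical_sets cardinality reals complex.
From mathcomp Require Import mpoly ring zify.

(** Let [f] be monic and centred of degree [d = e.+1], with critical points
    [c_i], and let [b] be a [d]-th root of [f.[0]]. Then [f] is determined by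
    [v = (c_1, ..., c_e, b)], and [f.[z]] is homogeneous of degree [d] in
    [(v, z)]. The main point is that if every critical orbit is finite, then all
    the entries of [v], hence all the coefficients of [f], are algebraic.

    Filter the rational algebra generated by the entries of [v] by the degree of
    polynomial expressions in them. For [n >= 1] the [n]-th iterate of [c_i] is,
    up to terms of lower degree, the power [f.[c_i] ^+ (d ^ n.-1)], of degree
    [d ^ n] ([orbit_top]). If it equals an earlier iterate, then that power is
    an expression of degree less than [d ^ n] ([preperiodic_top]); in other words,
    the classes of the critical values in the associated graded ring are
    nilpotent. They vanish under every homomorphism from the graded ring to a
    field. But a monic centred polynomial that vanishes at all of its critical
    points is a power of ['X] ([poly_of_crit_rigid]), so all the entries of [v]
    vanish under every such homomorphism as well, and are therefore nilpotent in the
    graded ring ([exists_field_avoiding], [var_nilpotent]). Thus a power of each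
    entry is an expression of lower degree, the filtration is stationary, and
    the algebra is finite-dimensional over the rationals
    ([preperiodic_algebraic]). This replaces the usual argument with valuations,
    in which the same estimates say that no entry of [v] has a pole at a place
    of residue characteristic 0.

    The subvarieties are the closed points given by the tuples of algebraic
    numbers, which form a countable set. Such a point is defined by the kernel
    of an evaluation; this ideal is maximal because the values are algebraic
    ([point_ideal_maximal]), so the dimension is 0. Every tuple of algebraic
    elements of a field of characteristic 0 satisfies all the rational equations
    satisfied by some tuple of algebraic numbers ([algebraic_specialization]),
    so every post-critically finite class lies on one of these points. *)

Set Implicit Arguments.
Unset Strict Implicit.
Unset Printing Implicit Defensive.

Import GRing.Theory Num.Theory.
Local Open Scope ring_scope.

(** * Ring homomorphisms to fields that detect non-nilpotent elements *)
Section Domain.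
Variable D : comNzRingType.
Hypothesis D_domain : forall x y : D, x * y = 0 -> (x == 0) || (y == 0).

(** An alias of [D] that carries the proof of integrality, so that the
    field-of-fractions construction can find it. *)
Definition domain_type of (forall x y : D, x * y = 0 -> (x == 0) || (y == 0)) :
  Type := D.
Local Notation T := (domain_type D_domain).
HB.instance Definition _ := GRing.ComNzRing.on T.

Definition domain_unit : {pred T} := fun x => `[< exists y : T, y * x = 1 >].
Definition domain_inv (x : T) : T :=
  if pselect (exists y : T, y * x = 1) is left h then sval (cid h) else x.

Lemma domain_mulVr : {in domain_unit, left_inverse 1 domain_inv *%R}.
Proof.
move=> x /asboolP ux; rewrite /domain_inv.
by case: pselect => // h; case: (cid h).
Qed.

Lemma domain_unitP (x y : T) : y * x = 1 -> domain_unit x.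
Proof. by move=> yx; apply/asboolP; exists y. Qed.

Lemma domain_inv_out : {in [predC domain_unit], domain_inv =1 id}.
Proof.
move=> x /negP ux; rewrite /domain_inv; case: pselect => // h.
by case: ux; apply/asboolP.
Qed.

HB.instance Definition _ := GRing.ComNzRing_hasMulInverse.Build T
  domain_mulVr domain_unitP domain_inv_out.
HB.instance Definition _ := GRing.ComUnitRing_isIntegral.Build T D_domain.

Lemma domain_embeds_in_field :
  exists (F : fieldType) (i : {rmorphism D -> F}), injective i.
Proof.
exists {fraction T}, (@tofrac T : {rmorphism T -> {fraction T}}).
by move=> x y /eqP; rewrite tofrac_eq => /eqP.
Qed.
End Domain.

Section PrimeQuotient.
Local Open Scope quotient_scope.
Variables (A : comNzRingType) (P : {pred A}).
Hypotheses (P_ideal : idealr_closed P) (P_prime : prime_idealr_closed P).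

(** An alias of [P] that carries the proofs of primality, so that the quotient
    ring construction can find them. *)
Definition prime_pred of idealr_closed P & prime_idealr_closed P : {pred A} :=
  P.
Local Notation P' := (prime_pred P_ideal P_prime).
HB.instance Definition _ := isIdealr.Build A P' P_ideal.
HB.instance Definition _ := isPrimeIdealrClosed.Build A P' P_prime.

Lemma prime_ideal_kernel :
  exists (F : fieldType) (phi : {rmorphism A -> F}),
    forall a, (phi a == 0) = (a \in P).
Proof.
have [F [i i_inj]] :=
  domain_embeds_in_field (@Quotient.rquot_IdomainAxiom A P').
exists F, (i \o \pi_{ideal_quot P'}) => a /=.
rewrite -(rmorph0 i) (inj_eq i_inj).
have := Quotient.idealrBE P' a 0; rewrite subr0 => aE.
by rewrite -(rmorph0 \pi_{ideal_quot P'}) -aE.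
Qed.
End PrimeQuotient.

Section Avoidance.
Local Open Scope classical_set_scope.
Variables (A : comNzRingType) (J : set A) (s : A).
Hypotheses (J0 : J 0) (J_add : forall a b, J a -> J b -> J (a + b))
  (J_mul : forall a b, J b -> J (a * b)) (J_avoid : forall n, ~ J (s ^+ n)).

Let avoiding (X : set A) :=
  [/\ J `<=` X, forall a b, X a -> X b -> X (a + b),
      forall a b, X b -> X (a * b) & forall n, ~ X (s ^+ n)].

(** Zorn's lemma is applied to the sets [X] such that [X `|` J], rather than
    [X], avoids the powers of [s]: the empty chain then has the upper bound
    [set0], because [J] itself is such a set. *)
Lemma maximal_avoiding :
  exists M, avoiding M /\ forall X, avoiding X -> M `<=` X -> X `<=` M.
Proof.
have [F FP Ftot|M [PM maxM]] :=
    @Zorn_bigcup A [set X | avoiding (X `|` J)]; last first.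
  exists (M `|` J); split=> // X [JX Xadd Xmul Xav] MX.
  have MX' : M `<=` X by move=> x Mx; apply: MX; left.
  have [XM|XM] := pselect (X `<=` M); first by move=> x /XM; left.
  by case: (maxM X (conj MX' XM)); rewrite /= (setUidl JX).
split=> [x Jx|a b [[X FX Xa]|Ja] [[Y FY Yb]|Jb]|a b [[X FX Xb]|Jb]|n []].
- by right.
- have [XY|YX] := Ftot _ _ FX FY.
    have [_ /(_ a b) YD _ _] := FP _ FY.
    have [] := YD (or_introl (XY _ Xa)) (or_introl Yb); last by right.
    by left; exists Y.
  have [_ /(_ a b) XD _ _] := FP _ FX.
  have [] := XD (or_introl Xa) (or_introl (YX _ Yb)); last by right.
  by left; exists X.
- have [_ /(_ a b) XD _ _] := FP _ FX.
  have [] := XD (or_introl Xa) (or_intror Jb); last by right.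
  by left; exists X.
- have [_ /(_ a b) YD _ _] := FP _ FY.
  have [] := YD (or_intror Ja) (or_introl Yb); last by right.
  by left; exists Y.
- by right; apply: J_add.
- have [_ _ /(_ a b) XM _] := FP _ FX.
  by have [] := XM (or_introl Xb); [left; exists X|right].
- by right; apply: J_mul.
- by move=> [X FX Xs]; have [_ _ _ /(_ n)] := FP _ FX; apply; left.
- exact: J_avoid.
Qed.

(** The nilradical is the intersection of the primes: an ideal [P] that is
    maximal among those containing [J] and avoiding the powers of [s] is prime,
    since [s ^+ n] in [P + (a)] and [s ^+ m] in [P + (b)] would put
    [s ^+ (n + m)] in [P + (a * b)], which is [P] if [a * b] is in [P]. The
    field is the fraction field of the quotient by [P]. *)
Lemma exists_field_avoiding :
  exists (F : fieldType) (phi : {rmorphism A -> F}),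
    (forall a, J a -> phi a = 0) /\ phi s != 0.
Proof.
have [M [[JM Madd Mmul Mav] maxM]] := maximal_avoiding.
pose P : {pred A} := fun a => `[< M a >].
have PM a : (a \in P) = `[< M a >] by [].
have extend a : a \notin P -> exists n b c, M c /\ s ^+ n = b * a + c.
  move=> aP; apply: contrapT => no.
  have: [set x | exists b c, M c /\ x = b * a + c] `<=` M.
    apply: maxM => [|x Mx]; last by exists 0, x; rewrite mul0r add0r.
    split=> [x /JM Mx|x y [b [c [Mc ->]]] [b' [c' [Mc' ->]]]|x y|n].
    - by exists 0, x; rewrite mul0r add0r.
    - by exists (b + b'), (c + c'); rewrite mulrDl addrACA; split; auto.
    - move=> [b [c [Mc ->]]]; exists (x * b), (x * c).
      by rewrite mulrDr mulrA; split; auto.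
    - by move=> [b [c [Mc sE]]]; apply: no; exists n, b, c.
  move/(_ a) => /= Ma; case/negP: aP; rewrite PM; apply/asboolP; apply: Ma.
  by exists 1, 0; rewrite mul1r addr0; split=> //; apply: JM.
have Pid : idealr_closed P.
  split=> [||a x y]; rewrite ?PM.
  - exact/asboolP/JM/J0.
  - by apply/asboolP => M1; apply: (Mav 0%N); rewrite expr0.
  - by move=> /asboolP Mx /asboolP My; apply/asboolP/Madd => //; apply: Mmul.
have Pprime : prime_idealr_closed P.
  move=> a b; rewrite [a * b \in _]PM => /asboolP Mab.
  apply: contrapT => /negP /norP [/extend [n [x [c [Mc sn]]]]].
  move=> /extend [m [y [c' [Mc' sm]]]]; apply: (Mav (n + m)%N).
  have -> : s ^+ (n + m) = (x * y) * (a * b) + ((y * b) * c + s ^+ n * c').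
    rewrite exprD sm mulrDr addrA; congr (_ + _).
    by rewrite sn mulrDl [c * _]mulrC mulrACA.
  exact: Madd (Mmul _ _ Mab) (Madd _ _ (Mmul _ _ Mc) (Mmul _ _ Mc')).
have [F [phi phiP]] := prime_ideal_kernel Pid Pprime.
exists F, phi; split=> [a Ja|]; last first.
  by rewrite phiP PM; apply/asboolP => Ms; apply: (Mav 1%N).
by apply/eqP; rewrite phiP PM; apply/asboolP/JM.
Qed.
End Avoidance.

(** * Monic polynomials given by their critical points *)
Lemma prod_XsubC_homog (B : comNzRingType) I (r : seq I) (f : I -> B) a j :
  (\prod_(i <- r) ('X - (a * f i)%:P))`_j * a ^+ j =
  a ^+ size r * (\prod_(i <- r) ('X - (f i)%:P))`_j.
Proof.
elim: r j => [|i r IHr] j /=.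
  by rewrite !big_nil expr0 mul1r coef1; case: j => [|j]; rewrite ?mulr1 ?mul0r.
rewrite !big_cons !mulrBl !coefB !coefXM !coefCM !mulrBr mulrBl exprSr.
congr (_ - _).
  case: j => [|j]; first by rewrite !mulr0 mul0r.
  by rewrite exprSr mulrA IHr mulrAC.
by rewrite -mulrA IHr mulrACA [a * _]mulrC; ring.
Qed.

Lemma prod_XsubC_dvdp (F : fieldType) (s : seq F) (f : {poly F}) :
    f != 0 -> (forall x, count_mem x s <= mup x f)%N ->
  \prod_(x <- s) ('X - x%:P) %| f.
Proof.
elim: s f => [|x s IHs] f f0 sf; first by rewrite big_nil dvd1p.
have: (0 < mup x f)%N by apply: leq_trans (sf x); rewrite /= eqxx.
rewrite -XsubC_dvd // => /dvdpP [g fE].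
rewrite big_cons fE [g * _]mulrC dvdp_mul2l ?polyXsubC_eq0 //.
have g0 : g != 0 by apply: contraNneq f0 => g0; rewrite fE g0 mul0r.
apply: IHs => // y; have := sf y.
rewrite fE mupM ?polyXsubC_eq0 // (@mup_XsubCX _ 1) /= addnC.
by rewrite leq_add2r.
Qed.

(** The multiplicity drops by one exactly; it is here that characteristic 0 is
    used, as the coefficient [k.+1] that appears must not vanish. *)
Lemma mup_deriv_lt (F : fieldType) (f : {poly F}) (x : F) :
    [pchar F] =i pred0 -> f != 0 -> root f x -> (mup x f^`() < mup x f)%N.
Proof.
move=> F0 f0 fx; have [k [q]] := multiplicity_XsubC f x; rewrite f0 /= => qx fE.
case: k => [|k] in fE; first by rewrite fE mulr1 (negPf qx) in fx.
have x0 := polyXsubC_eq0 x.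
rewrite fE mupMr // (mup_XsubCX k.+1) eqxx derivM deriv_exp derivXsubC mul1r.
have -> : q^`() * ('X - x%:P) ^+ k.+1 + q * (('X - x%:P) ^+ k *+ k.+1) =
   (q^`() * ('X - x%:P) + q *+ k.+1) * ('X - x%:P) ^+ k.
  by rewrite [in RHS]mulrDl exprS mulrA mulrnAl mulrnAr.
rewrite mupMr ?mup_XsubCX ?eqxx //.
rewrite rootE !hornerE subrr mulr0 add0r hornerMn -mulr_natr mulf_eq0.
by rewrite -rootE (negPf qx); move/pcharf0P: F0 => ->.
Qed.

Lemma ratD_mulrn (B : comNzRingType) (iota : {rmorphism rat -> B}) n j :
  iota (n%:R / j.+1%:R) *+ j.+1 = n%:R.
Proof.
rewrite -[_ *+ j.+1]mulr_natr -(rmorph_nat iota j.+1) -rmorphM.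
by rewrite divfK; [exact: rmorph_nat|rewrite pnatr_eq0].
Qed.

(** A vector [v] of [e.+1] entries stands for [e] critical points (its first
    entries) and for a [e.+1]-st root of the value at 0 (its last entry).
    Taking a root of the value at 0 gives all the entries of [v] the same
    weight 1, so that no weighted degrees are needed below. *)
Section PolyOfCrit.
Variable e : nat.

Definition crit_pt (B : Type) (v : 'I_e.+1 -> B) (i : 'I_e) : B :=
  v (widen_ord (leqnSn e) i).

Definition crit_poly (B : comNzRingType) (v : 'I_e.+1 -> B) : {poly B} :=
  \prod_(i < e) ('X - (crit_pt v i)%:P).

(** The primitive of [e.+1 * crit_poly v] whose value at 0 is the [e.+1]-st
    power of the last entry. The base ring is arbitrary because the construction
    is used for numbers, for variables and for their images in other fields. *)
Definition poly_of_crit (B : comNzRingType) (iota : rat -> B)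
    (v : 'I_e.+1 -> B) :
    {poly B} :=
  \poly_(j < e.+2)
    if j is i.+1 then iota (e.+1%:R / j%:R) * (crit_poly v)`_i
    else v ord_max ^+ e.+1.

Lemma size_crit_poly (B : comNzRingType) (v : 'I_e.+1 -> B) :
  size (crit_poly v) = e.+1.
Proof.
by rewrite size_prod_XsubC /index_enum -enumT size_enum_ord.
Qed.

Lemma crit_poly_lead (B : comNzRingType) (v : 'I_e.+1 -> B) :
  (crit_poly v)`_e = 1.
Proof.
have := monic_prod_XsubC (index_enum 'I_e) xpredT (crit_pt v).
by rewrite monicE lead_coefE -/(crit_poly v) size_crit_poly => /eqP.
Qed.

Lemma crit_poly_subleading (B : idomainType) (v : 'I_e.+1 -> B) : (0 < e)%N ->
  (crit_poly v)`_e.-1 = - \sum_(i < e) crit_pt v i.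
Proof.
move=> e_gt0; have sz : size (map (crit_pt v) (index_enum 'I_e)) = e.
  by rewrite size_map /index_enum -enumT size_enum_ord.
have := @coefPn_prod_XsubC _ (map (crit_pt v) (index_enum 'I_e)).
by rewrite sz !big_map; apply; rewrite -lt0n.
Qed.

Lemma map_crit_poly (B C : comNzRingType) (phi : {rmorphism B -> C})
    (v : 'I_e.+1 -> B) :
  map_poly phi (crit_poly v) = crit_poly (phi \o v).
Proof.
rewrite /crit_poly rmorph_prod; apply: eq_bigr => i _.
by rewrite rmorphB /= map_polyX map_polyC.
Qed.

Lemma map_poly_of_crit (B C : comNzRingType) (phi : {rmorphism B -> C})
    (iota : rat -> B) (v : 'I_e.+1 -> B) :
  map_poly phi (poly_of_crit iota v) = poly_of_crit (phi \o iota) (phi \o v).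
Proof.
apply/polyP => -[|j]; rewrite coef_map !coef_poly /=; first exact: rmorphXn.
case: ifP => _; last exact: rmorph0.
by rewrite rmorphM -map_crit_poly coef_map.
Qed.

Lemma poly_of_crit_coef0 (B : comNzRingType) (iota : rat -> B)
    (v : 'I_e.+1 -> B) :
  (poly_of_crit iota v)`_0 = v ord_max ^+ e.+1.
Proof. by rewrite coef_poly. Qed.

Lemma poly_of_crit_coefS (B : comNzRingType) (iota : rat -> B)
    (v : 'I_e.+1 -> B) j :
  (poly_of_crit iota v)`_j.+1 = iota (e.+1%:R / j.+1%:R) * (crit_poly v)`_j.
Proof.
rewrite coef_poly ltnS; case: ltnP => // le_j.
by rewrite [X in _ * X]nth_default ?mulr0 // size_crit_poly.
Qed.

Lemma deriv_poly_of_crit (B : comNzRingType) (iota : {rmorphism rat -> B})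
    (v : 'I_e.+1 -> B) :
  (poly_of_crit iota v)^`() = e.+1%:R *: crit_poly v.
Proof.
apply/polyP => j; rewrite coef_deriv poly_of_crit_coefS coefZ.
by rewrite -mulrnAl ratD_mulrn.
Qed.

Lemma poly_of_crit_lead (B : comNzRingType) (iota : {rmorphism rat -> B})
    (v : 'I_e.+1 -> B) : (poly_of_crit iota v)`_e.+1 = 1.
Proof.
by rewrite poly_of_crit_coefS crit_poly_lead mulr1 divff ?pnatr_eq0 ?rmorph1.
Qed.

Lemma size_poly_of_crit (B : comNzRingType) (iota : {rmorphism rat -> B})
    (v : 'I_e.+1 -> B) : size (poly_of_crit iota v) = e.+2.
Proof.
apply/anti_leq; rewrite size_poly ltnNge;
  apply/negP => /leq_sizeP /(_ _ (leqnn _)).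
by move/eqP; rewrite poly_of_crit_lead oner_eq0.
Qed.

Lemma crit_poly_homog (B : comNzRingType) (v : 'I_e.+1 -> B) (a : B) j :
  (crit_poly (fun i => a * v i))`_j * a ^+ j = a ^+ e * (crit_poly v)`_j.
Proof.
have := prod_XsubC_homog (index_enum 'I_e) (crit_pt v) a j.
by rewrite {2}/index_enum -enumT size_enum_ord.
Qed.

(** [poly_of_crit v] at [z] is homogeneous of degree [e.+1] in [(v, z)]: each
    [(crit_poly v)`_j] is homogeneous of degree [e - j] in [v]. *)
Lemma poly_of_crit_homog (B : comNzRingType) (iota : rat -> B)
    (v : 'I_e.+1 -> B) a z :
  (poly_of_crit iota (fun i => a * v i)).[a * z] =
  a ^+ e.+1 * (poly_of_crit iota v).[z].
Proof.
rewrite !horner_poly mulr_sumr; apply: eq_bigr => -[[|j] lt_j] _ /=.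
  by rewrite !mulr1 exprMn.
rewrite exprMn -!mulrA; set c := iota _; set p := (crit_poly v)`_j.
have := crit_poly_homog v a j; rewrite -/p; set q := _`_j => qE.
have -> : c * (q * (a ^+ j.+1 * z ^+ j.+1)) =
    (q * a ^+ j) * (a * c * z ^+ j.+1).
  by rewrite [a ^+ j.+1]exprS; ring.
by rewrite qE [a ^+ e.+1]exprS; ring.
Qed.

(** If all the critical points of a centred [f] are roots of [f], then [f] is a
    power of ['X]. Indeed a critical point of multiplicity [k] is then a root of
    [f] of multiplicity at least [k], so [crit_poly v] divides [f], hence also
    [g = e.+1 *: f - 'X * f^`()]. The two leading terms of [g] cancel, because
    [f] is monic and centred; so [g] has smaller degree than [crit_poly v],
    hence is zero, and this says that [f] is homogeneous. *)
Lemma poly_of_crit_rigid (F : fieldType) (iota : {rmorphism rat -> F})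
    (v : 'I_e.+1 -> F) :
    (0 < e)%N -> \sum_(i < e) crit_pt v i = 0 ->
    (forall i : 'I_e, (poly_of_crit iota v).[crit_pt v i] = 0) ->
  forall i, v i = 0.
Proof.
move=> e_gt0 v_sum v_root; set f := poly_of_crit iota v in v_root *.
have nat0 n : (n.+1%:R == 0 :> F) = false.
  by rewrite -(rmorph_nat iota) fmorph_eq0 pnatr_eq0.
have F0 : [pchar F] =i pred0 by apply/pcharf0P => -[|n]; rewrite ?eqxx ?nat0.
have f0 : f != 0 by rewrite -size_poly_eq0 size_poly_of_crit.
have pf : crit_poly v %| f.
  rewrite /crit_poly -(big_map (crit_pt v) xpredT (fun x => 'X - x%:P)).
  apply: prod_XsubC_dvdp => // x.
  have [|xr] := boolP (x \in map (crit_pt v) (index_enum 'I_e)); last first.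
    by rewrite (count_memPn xr).
  move=> /mapP [i _ xE]; rewrite -mu_prod_XsubC big_map -/(crit_poly v).
  have <- : mup x f^`() = mup x (crit_poly v).
    rewrite deriv_poly_of_crit -mul_polyC mupMr // rootC nat0 //.
  by apply/ltnW/mup_deriv_lt => //; rewrite rootE xE v_root.
(* Euler's operator: [g] vanishes exactly when [f] is homogeneous. *)
pose g := e.+1%:R *: f - 'X * f^`().
have gE j : g`_j = (e.+1%:R - j%:R) * f`_j.
  rewrite coefB coefZ coefXM coef_deriv mulrBl; congr (_ - _).
  by case: j => [|j] /=; rewrite ?mul0r // mulr_natl.
have g0 : g = 0.
  apply/eqP; apply: contraTT (dvdpp (crit_poly v)) => g_neq0.
  have: crit_poly v %| g.
    rewrite dvdp_sub ?dvdpZr ?nat0 // deriv_poly_of_crit.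
    rewrite -scalerAr dvdpZr ?nat0 //.
    exact: dvdp_mull.
  move/(dvdp_leq g_neq0); rewrite size_crit_poly => e_lt.
  suff : (size g <= e)%N by rewrite leqNgt e_lt.
  apply/leq_sizeP => j; rewrite leq_eqVlt => /predU1P [<-|]; last first.
    rewrite leq_eqVlt => /predU1P [<-|lt_j]; first by rewrite gE subrr mul0r.
    by rewrite gE [f`__]nth_default ?mulr0 // size_poly_of_crit.
  rewrite gE.
  have -> : f`_e = 0; last by rewrite mulr0.
  by rewrite -[X in _`_X](prednK e_gt0) poly_of_crit_coefS
    crit_poly_subleading // v_sum oppr0 mulr0.
have fE : f = 'X^(e.+1).
  apply/polyP => j; rewrite coefXn; have [->|je] := eqVneq j e.+1.
    exact: poly_of_crit_lead.
  have [lt_ej|le_je] := ltnP e.+1 j;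
    first by rewrite nth_default ?size_poly_of_crit.
  have := gE j; rewrite g0 coef0 -natrB // => /esym/eqP; rewrite mulf_eq0.
  case: (e.+1 - j)%N (subn_gt0 j e.+1) => [|n _]; last by rewrite nat0 => /eqP.
  by rewrite ltnn ltn_neqAle je le_je.
move=> i; have [lt_ie|le_ei] := ltnP i e; last first.
  have -> : i = ord_max by apply/val_inj/anti_leq; rewrite le_ei -ltnS ltn_ord.
  have := congr1 (fun p : {poly F} => p`_0) fE.
  by rewrite poly_of_crit_coef0 coefXn /= => /eqP;
    rewrite expf_eq0 => /andP [_ /eqP].
have -> : i = widen_ord (leqnSn e) (Ordinal lt_ie) by apply/val_inj.
have := v_root (Ordinal lt_ie); rewrite fE hornerXn => /eqP.
by rewrite expf_eq0 => /andP [_ /eqP].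
Qed.
End PolyOfCrit.

(** * The degree filtration of a finitely generated algebra of numbers *)
Section DegreeFiltration.
Variables (K : fieldType) (iota : {rmorphism rat -> K}).
Variables (n : nat) (v : 'I_n -> K).
Local Notation A := {mpoly rat[n]}.
Local Notation ev := (mmap iota v).

(** The strict inequality makes [deg_lt k.+1] the [k]-th step of the filtration
    and [deg_lt k] the step below it, including the zero step [deg_lt 0]. *)
Definition deg_lt (k : nat) (y : K) : Prop :=
  exists2 p : A, (msize p <= k)%N & ev p = y.

Lemma deg_lt_leq k l y : (k <= l)%N -> deg_lt k y -> deg_lt l y.
Proof. by move=> kl [p pk <-]; exists p => //; apply: leq_trans kl. Qed.

Lemma deg_lt0 k : deg_lt k 0.
Proof. by exists 0; rewrite ?msize0 ?rmorph0. Qed.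

Lemma deg_ltD k y z : deg_lt k y -> deg_lt k z -> deg_lt k (y + z).
Proof.
move=> [p pk <-] [q qk <-]; exists (p + q); last exact: rmorphD.
by apply: leq_trans (msizeD_le p q) _; rewrite geq_max pk.
Qed.

Lemma deg_ltN k y : deg_lt k y -> deg_lt k (- y).
Proof. by move=> [p pk <-]; exists (- p); rewrite ?msizeN ?rmorphN. Qed.

Lemma deg_lt_sum k I (r : seq I) (F : I -> K) :
  (forall i, deg_lt k (F i)) -> deg_lt k (\sum_(i <- r) F i).
Proof.
move=> FP; elim/big_rec: _ => [|i y _]; first exact: deg_lt0.
exact: deg_ltD.
Qed.

Lemma deg_ltM k l y z : deg_lt k.+1 y -> deg_lt l z -> deg_lt (k + l) (y * z).
Proof.
move=> [p pk <-] [q ql <-]; exists (p * q); last exact: rmorphM.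
have [->|p0] := eqVneq p 0; first by rewrite mul0r msize0.
have [->|q0] := eqVneq q 0; first by rewrite mulr0 msize0.
by rewrite msizeM // -subn1 leq_subLR add1n -addSn leq_add.
Qed.

Lemma deg_lt_rat c : deg_lt 1 (iota c).
Proof. by exists c%:MP; rewrite ?msizeC ?leq_b1 //; apply: mmapC. Qed.

Lemma deg_lt_one : deg_lt 1 1.
Proof. by rewrite -(rmorph1 iota); apply: deg_lt_rat. Qed.

Lemma deg_lt_var i : deg_lt 2 (v i).
Proof. by exists 'X_i; rewrite ?msizeX ?mdeg1 // mmapX mmap1U. Qed.

Lemma deg_lt_exp k l y : deg_lt k.+1 y -> deg_lt (l * k).+1 (y ^+ l).
Proof.
move=> yk; elim: l => [|l IHl]; first exact: deg_lt_one.
by rewrite exprS mulSn -addnS; apply: deg_ltM.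
Qed.

Lemma deg_lt_congr_exp k l y z :
    deg_lt k.+1 y -> deg_lt k.+1 z -> deg_lt k (y - z) ->
  deg_lt (l * k) (y ^+ l - z ^+ l).
Proof.
move=> yk zk yz; elim: l => [|l IHl]; first by rewrite subrr; apply: deg_lt0.
have -> : y ^+ l.+1 - z ^+ l.+1 = y * (y ^+ l - z ^+ l) + z ^+ l * (y - z).
  by rewrite !exprS; ring.
apply: deg_ltD; first by rewrite mulSn; apply: deg_ltM.
by rewrite mulSnr; apply: deg_ltM => //; apply: deg_lt_exp.
Qed.

(** The coefficient of ['X^k] in [gr_eval p] is the value at [v] of the
    homogeneous component of degree [k] of [p]. This is the evaluation of [p] in
    the Rees algebra of the filtration, with ['X] as the Rees parameter. *)
Definition gr_eval : A -> {poly K} :=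
  mmap (polyC \o iota) (fun i => 'X * (v i)%:P).
HB.instance Definition _ := GRing.RMorphism.on gr_eval.

Lemma gr_eval_var i : gr_eval 'X_i = 'X * (v i)%:P.
Proof. by rewrite /gr_eval mmapX mmap1U. Qed.

Lemma gr_eval_monomial m : gr_eval 'X_[m] = 'X^(mdeg m) * (ev 'X_[m])%:P.
Proof.
rewrite /gr_eval !mmapX mdegE /mmap1 rmorph_prod expr_sum -big_split /=.
by apply: eq_bigr => i _; rewrite exprMn rmorphXn.
Qed.

Lemma gr_eval_coef p k : deg_lt k.+1 (gr_eval p)`_k.
Proof.
rewrite [p]mpolyE rmorph_sum coef_sum; apply: deg_lt_sum => m.
rewrite -mul_mpolyC rmorphM /= gr_eval_monomial [gr_eval _%:MP]mmapC /=.
rewrite coefCM coefXnM coefC -[k.+1]add0n.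
apply: deg_ltM; first exact: deg_lt_rat.
have [_|le_mk] := ltnP k (mdeg m); first exact: deg_lt0.
case: eqP => _; last exact: deg_lt0.
by exists 'X_[m]; rewrite ?msizeX.
Qed.

(** The kernel of the map from polynomials to the associated graded ring of
    the filtration, which is the Rees algebra modulo its parameter ['X]. *)
Definition gr_ideal (p : A) : Prop := forall k, deg_lt k (gr_eval p)`_k.

Lemma gr_ideal0 : gr_ideal 0.
Proof. by move=> k; rewrite rmorph0 coef0; apply: deg_lt0. Qed.

Lemma gr_idealD p q : gr_ideal p -> gr_ideal q -> gr_ideal (p + q).
Proof. by move=> pJ qJ k; rewrite rmorphD coefD; apply: deg_ltD. Qed.

Lemma gr_idealM p q : gr_ideal q -> gr_ideal (p * q).
Proof.
move=> qJ k; rewrite rmorphM coefM; apply: deg_lt_sum => i.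
by rewrite -[k in deg_lt k](subnKC (ltn_ord i : (i <= k)%N));
   apply: deg_ltM => //; apply: gr_eval_coef.
Qed.

(** If the filtration is stationary, the algebra generated by [v] is spanned by
    finitely many monomials; the vector of their values is then an eigenvector,
    with eigenvalue [ev p], of a matrix with rational entries. *)
Lemma bounded_degree_algebraic D :
    (forall k y, deg_lt k y -> deg_lt D y) ->
  forall p, algebraicOver iota (ev p).
Proof.
move=> bounded p; pose N := #|{: 'X_{1..n < D}}|.
pose bm (j : 'I_N) : 'X_{1..n < D} := enum_val j.
pose mon j : A := 'X_[bm j].
have expand j : exists c : 'I_N -> rat,
    ev p * ev (mon j) = \sum_l iota (c l) * ev (mon l).
  have [|q qD qE] := bounded (msize (p * mon j)) (ev p * ev (mon j)).
    by exists (p * mon j); rewrite ?rmorphM.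
  exists (fun l => q@_(bm l)); rewrite -qE [in LHS](mpolywE qD) rmorph_sum /=.
  rewrite (reindex bm) /=; last exact/onW_bij/enum_val_bij.
  by apply: eq_bigr => l _; rewrite mmapZ.
pose M : 'M[rat]_N := \matrix_(l, j) sval (cid (expand j)) l.
pose w : 'rV[K]_N := \row_j ev (mon j).
exists (char_poly M); first exact/monic_neq0/char_poly_monic.
rewrite map_char_poly -eigenvalue_root_char; apply/eigenvalueP; exists w.
  apply/rowP => j; rewrite !mxE.
  have cE := svalP (cid (expand j)); rewrite [RHS]cE.
  by apply: eq_bigr => l _; rewrite !mxE mulrC.
(* The vector is nonzero because 1 is among the monomials, provided [D] is
   not 0. *)
have [D0|D_gt0] := posnP D.
  have [p1] := bounded 1%N 1 (deg_lt_one).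
  rewrite D0 leqn0 msize_poly_eq0 => /eqP -> /eqP.
  by rewrite rmorph0 eq_sym oner_eq0.
have lt0D : (mdeg (0%MM : 'X_{1..n}) < D)%N by rewrite mdeg0.
apply/negP => /eqP/rowP /(_ (enum_rank (BMultinom lt0D))).
rewrite !mxE /mon /bm enum_rankK /= mpolyX0 rmorph1 => /eqP.
by rewrite oner_eq0.
Qed.

(** A monomial of degree larger than the sum of the [N i] contains some
    [v i ^+ N i], which can be replaced by an expression of lower degree. *)
Lemma bounded_degree (N : 'I_n -> nat) :
    (forall i, deg_lt (N i) (v i ^+ N i)) ->
  exists D, forall k y, deg_lt k y -> deg_lt D y.
Proof.
(* With the successor, the bound also works when there is no variable. *)
move=> vN; exists (\sum_i N i).+1; set D := _.+1 => k.
have [kD y|] := leqP k D; first exact: deg_lt_leq.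
move/ltnW/subnKC <-; elim: (k - D)%N => [|l IHl] y; first by rewrite addn0.
rewrite addnS; set k' := (D + l)%N in IHl *; move=> [p pk' <-]; apply: IHl.
rewrite [p]mpolyE rmorph_sum /= big_seq.
elim/big_rec: _ => [|m y' /msize_mdeg_lt m_lt]; first exact: deg_lt0.
apply: deg_ltD; rewrite mmapZ -[k']add0n; apply: deg_ltM.
  exact: deg_lt_rat.
have [lt_m|le_m] := ltnP (mdeg m) k'; first by exists 'X_[m]; rewrite ?msizeX.
have [i lt_i] : exists i, (N i <= m i)%N.
  apply/existsP; apply: contraTT le_m => /existsPn no.
  rewrite -ltnNge mdegE (leq_trans _ (leq_addr l D)) // ltnS.
  by apply: leq_sum => i _; rewrite ltnW // ltnNge.
pose m' := (m - U_(i) *+ N i)%MM.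
have mE : m = (m' + U_(i) *+ N i)%MM.
  rewrite submK //; apply/mnm_lepP => j; rewrite mulmnE mnm1E.
  by case: eqP => [<-|_]; rewrite ?mul1n ?mul0n.
have degm : mdeg m = (mdeg m' + N i)%N.
  by rewrite {1}mE mdegD mdegMn mdeg1 mul1n.
rewrite mE mpolyXD -mpolyXn rmorphM rmorphXn /= [ev 'X_i]mmapX mmap1U.
apply: (deg_lt_leq (k := (mdeg m' + N i)%N));
  first by rewrite -degm -ltnS (leq_trans m_lt).
by apply: deg_ltM => //; exists 'X_[m']; rewrite ?msizeX.
Qed.

End DegreeFiltration.

(** * Finite critical orbits bound the degree *)
Section Escape.
Variables (K : fieldType) (iota : {rmorphism rat -> K}) (e : nat).
Variable v : 'I_e.+1 -> K.
Local Notation A := {mpoly rat[e.+1]}.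
Local Notation deg_lt := (deg_lt iota v).
Local Notation f := (poly_of_crit iota v).

Lemma deg_lt_prod_XsubC (r : seq 'I_e) j : (j <= size r)%N ->
  deg_lt (size r - j).+1 (\prod_(i <- r) ('X - (crit_pt v i)%:P))`_j.
Proof.
elim: r j => [|i r IHr] [|j] //= le_j.
- by rewrite big_nil coef1; apply: deg_lt_one.
- rewrite big_cons mulrBl coefB coefXM coefCM /= sub0r -mulrN.
  rewrite -(subn0 (size r).+1).
  have -> : ((size r).+1 - 0).+1 = (1 + (size r).+1)%N by lia.
  apply: deg_ltM; first exact: deg_lt_var.
  by apply: deg_ltN; rewrite -[size r]subn0; apply: IHr.
rewrite big_cons mulrBl coefB coefXM coefCM /= subSS.
apply: deg_ltD; first exact: IHr.
apply: deg_ltN; have [lt_jr|le_rj] := ltnP j (size r).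
  have -> : (size r - j).+1 = (1 + (size r - j.+1).+1)%N by lia.
  by apply: deg_ltM; [apply: deg_lt_var | apply: IHr].
rewrite [X in _ * X]nth_default ?mulr0; first exact: deg_lt0.
by rewrite size_prod_XsubC.
Qed.

Lemma deg_lt_poly_of_crit j : (j <= e.+1)%N -> deg_lt (e.+1 - j).+1 f`_j.
Proof.
case: j => [|j] le_j.
  rewrite poly_of_crit_coef0 subn0 -[X in deg_lt X.+1]muln1.
  exact/deg_lt_exp/deg_lt_var.
rewrite poly_of_crit_coefS subSS -[X in deg_lt X]add0n; apply: deg_ltM;
  first exact: deg_lt_rat.
have sz : size (index_enum 'I_e) = e.
  by rewrite /index_enum -enumT size_enum_ord.
by have := @deg_lt_prod_XsubC (index_enum 'I_e) j; rewrite sz; apply.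
Qed.

Lemma deg_lt_poly_of_crit_term D j y : (j <= e.+1)%N -> deg_lt D.+1 y ->
  deg_lt (e.+1 - j + (j * D)).+1 (f`_j * y ^+ j).
Proof.
move=> le_j yD; rewrite -addnS; apply: deg_ltM;
  first exact: deg_lt_poly_of_crit.
exact: deg_lt_exp.
Qed.

Hypothesis e_gt0 : (0 < e)%N.

Lemma deg_lt_poly_of_crit_horner D y : (0 < D)%N -> deg_lt D.+1 y ->
  deg_lt (e.+1 * D).+1 f.[y].
Proof.
move=> D_gt0 yD; rewrite horner_coef size_poly_of_crit; apply: deg_lt_sum => j.
have le_j : (j <= e.+1)%N by rewrite -ltnS.
by apply: deg_lt_leq (deg_lt_poly_of_crit_term le_j yD); nia.
Qed.

(** The coefficient of degree [j] has degree at most [e.+1 - j] in [v], so when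
    the degree [D] of [y] exceeds 1, replacing a factor [y] by coefficients
    lowers the degree. *)
Lemma poly_of_crit_horner_top D y : (1 < D)%N -> deg_lt D.+1 y ->
  deg_lt (e.+1 * D) (f.[y] - y ^+ e.+1).
Proof.
move=> D_gt1 yD; rewrite horner_coef size_poly_of_crit big_ord_recr /=
  poly_of_crit_lead mul1r addrK.
apply: deg_lt_sum => j; have lt_j := ltn_ord j.
by apply: deg_lt_leq (deg_lt_poly_of_crit_term (ltnW lt_j) yD); nia.
Qed.

Local Notation orbit i k := (iter k (horner f) (crit_pt v i)).

Lemma deg_lt_orbit i k : deg_lt (e.+1 ^ k).+1 (orbit i k).
Proof.
elim: k => [|k IHk] /=; first by rewrite expn0; apply: deg_lt_var.
by rewrite expnS; apply: deg_lt_poly_of_crit_horner => //; rewrite expn_gt0.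
Qed.

(** By iteration, the leading form of the [k.+1]-st iterate of a critical point
    is a power of the leading form of its first iterate, the critical value. *)
Lemma orbit_top i k :
  deg_lt (e.+1 ^ k.+1) (orbit i k.+1 - f.[crit_pt v i] ^+ (e.+1 ^ k)).
Proof.
elim: k => [|k IHk]; first by rewrite expn0 subrr; apply: deg_lt0.
rewrite expnS [X in _ ^+ X]expnSr exprM.
set y := _ ^+ (e.+1 ^ k) in IHk *; set u := orbit i k.+1 in IHk.
have -> : orbit i k.+2 - y ^+ e.+1 =
    (f.[u] - u ^+ e.+1) + (u ^+ e.+1 - y ^+ e.+1).
  by rewrite addrA subrK.
apply: deg_ltD.
  apply: poly_of_crit_horner_top; last exact: deg_lt_orbit.
  by rewrite -[1%N](expn0 e.+1) ltn_exp2l.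
apply: deg_lt_congr_exp => //; first exact: deg_lt_orbit.
rewrite expnSr; apply: deg_lt_exp.
by have := deg_lt_orbit i 1; rewrite expn1.
Qed.

(** The two members of [orbit i a = orbit i b] have filtration degrees
    [e.+1 ^ a] and [e.+1 ^ b], so the leading form of the second vanishes. *)
Lemma preperiodic_top i a b : (a < b)%N -> orbit i a = orbit i b ->
  deg_lt (e.+1 ^ b) (f.[crit_pt v i] ^+ (e.+1 ^ b.-1)).
Proof.
case: b => // b lt_ab ab; have := orbit_top i b; rewrite -ab /= => top.
rewrite -[_ ^+ _](subKr (orbit i a)); apply: deg_ltD; last exact: deg_ltN.
by apply: deg_lt_leq (deg_lt_orbit i a); rewrite ltn_exp2l.
Qed.

Definition generic_poly : {poly A} :=
  poly_of_crit (@mpolyC e.+1 rat) (fun i => 'X_i).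
Definition generic_value (i : 'I_e) : A :=
  generic_poly.[crit_pt (fun i => 'X_i) i].

Lemma gr_eval_generic_value i :
  gr_eval iota v (generic_value i) = 'X^(e.+1) * (f.[crit_pt v i])%:P.
Proof.
rewrite -[LHS]horner_map map_poly_of_crit /= [gr_eval _ _ _]gr_eval_var.
have -> : gr_eval iota v \o @mpolyC e.+1 rat = polyC \o iota.
  by apply: funext => c /=; apply: mmapC.
have -> : gr_eval iota v \o (fun i => 'X_i) = fun i => 'X * (polyC \o v) i.
  by apply: funext => j /=; apply: gr_eval_var.
by rewrite poly_of_crit_homog -map_poly_of_crit horner_map.
Qed.

Hypothesis crit_preperiodic : forall i : 'I_e,
  exists a b, (a < b)%N /\ orbit i a = orbit i b.
Hypothesis centred : \sum_(i < e) crit_pt v i = 0.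

Lemma generic_value_gr_ideal i :
  exists M, gr_ideal iota v (generic_value i ^+ M).
Proof.
have [a [b [lt_ab ab]]] := crit_preperiodic i.
exists (e.+1 ^ b.-1)%N => k.
rewrite rmorphXn /= gr_eval_generic_value exprMn -rmorphXn /= -exprM.
rewrite coefXnM coefC subn_eq0 -expnS (ltn_predK lt_ab).
have [lt_kb|le_bk] := ltnP; first exact: deg_lt0.
case: leqP => [le_kb|_]; last exact: deg_lt0.
by apply: deg_lt_leq (preperiodic_top lt_ab ab).
Qed.

Lemma sum_vars_gr_ideal :
  gr_ideal iota v (\sum_(i < e) crit_pt (fun i => 'X_i) i).
Proof.
move=> k; rewrite rmorph_sum (eq_bigr (fun i => 'X * (crit_pt v i)%:P)) /=.
  by rewrite -mulr_sumr -rmorph_sum centred mulr0 coef0; apply: deg_lt0.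
by move=> i _; apply: gr_eval_var.
Qed.

(** Otherwise some field receives the associated graded ring with ['X_j] not
    sent to 0. The critical values are nilpotent in the graded ring, so they
    vanish in that field, and [poly_of_crit_rigid] says that all the variables
    vanish there too. *)
Lemma var_nilpotent j : exists N, gr_ideal iota v ('X_j ^+ N).
Proof.
apply: contrapT => no.
have [|||N XN|F [phi [phiJ]]] :=
    @exists_field_avoiding _ (gr_ideal iota v) 'X_j.
- exact: gr_ideal0.
- exact: gr_idealD.
- exact: gr_idealM.
- by apply: no; exists N.
apply/negP; rewrite negbK; apply/eqP.
apply: (@poly_of_crit_rigid e F (phi \o @mpolyC e.+1 rat)
  (phi \o (fun i => 'X_i))) => //.
  rewrite -[RHS](phiJ _ sum_vars_gr_ideal) rmorph_sum; exact: eq_bigr.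
move=> i; have [M /phiJ] := generic_value_gr_ideal i.
rewrite rmorphXn -map_poly_of_crit /crit_pt /= horner_map => /eqP.
by rewrite expf_eq0 => /andP [_ /eqP].
Qed.

Lemma preperiodic_algebraic p : algebraicOver iota (mmap iota v p).
Proof.
have [N NP] := choice var_nilpotent.
have [|D Dbound] := @bounded_degree _ iota _ v N.
  move=> i; have := NP i (N i).
  by rewrite rmorphXn /= gr_eval_var exprMn -rmorphXn coefXnM ltnn subnn coefC.
exact: bounded_degree_algebraic Dbound p.
Qed.

End Escape.

(** * Reduction to monic centred polynomials *)

(** Nonzero integers stay nonzero in [K], and [ratr] needs no more than this to
    respect sums and products of fractions. The equality of functions allows the
    bare [ratr] of the definitions to be replaced by a morphism. *)
Lemma ratr_morphism (K : fieldType) : [pchar K] =i pred0 ->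
  exists iota : {rmorphism rat -> K}, (iota : rat -> K) = ratr.
Proof.
move=> K0; have intr0 (m : int) : m != 0 -> m%:~R != 0 :> K.
  move/pcharf0P: K0 => K0; case: m => n n0;
    rewrite ?NegzE ?rmorphN ?oppr_eq0 /=;
  by rewrite -pmulrn K0.
have den0 (x : rat) : (denq x)%:~R != 0 :> K by apply/intr0/denq_neq0.
have ratrE (x : rat) (a b : int) : b != 0 -> x = a%:Q / b%:Q ->
    ratr x = a%:~R / b%:~R :> K.
  move=> b0 xE; apply/eqP; rewrite /ratr eqr_div ?intr0 // -!rmorphM /=.
  have : numq x * b = a * denq x.
    apply: (@intr_inj rat); rewrite !rmorphM /= numqE mulrAC xE divfK //.
    by rewrite intr_eq0.
  by move=> ->.
have add : zmod_morphism (ratr : rat -> K).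
  move=> x y.
  rewrite (ratrE (x - y) (numq x * denq y - numq y * denq x) (denq x * denq y)).
  - by rewrite !rmorphM rmorphB !rmorphM /= /ratr; field; rewrite !den0.
  - by rewrite mulf_neq0 ?denq_neq0.
  - rewrite -[x in LHS]divq_num_den -[y in LHS]divq_num_den !rmorphM rmorphB
    !rmorphM /=.
    by field; rewrite !intr_eq0 !denq_neq0.
have mul : monoid_morphism (ratr : rat -> K).
  split=> [|x y]; first by rewrite /ratr divr1.
  rewrite (ratrE (x * y) (numq x * numq y) (denq x * denq y)).
  - by rewrite !rmorphM /= /ratr; field; rewrite !den0.
  - by rewrite mulf_neq0 ?denq_neq0.
  - rewrite -[x in LHS]divq_num_den -[y in LHS]divq_num_den !rmorphM /=.
    by field; rewrite !intr_eq0 !denq_neq0.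
pose i1 := GRing.isZmodMorphism.Build rat K (ratr : rat -> K) add.
pose i2 := GRing.isMonoidMorphism.Build rat K (ratr : rat -> K) mul.
pose iota : {rmorphism rat -> K} :=
  HB.pack (ratr : rat -> K) i1 i2.
by exists iota.
Qed.

Section Conjugation.
Local Open Scope classical_set_scope.
Variables (K : fieldType) (alpha gamma : K) (f : {poly K}).
Hypothesis alpha0 : alpha != 0.
Local Notation g := (affine_conj alpha gamma f).
Let h z := alpha * z + gamma.

Lemma horner_affine_conj z : h g.[z] = f.[h z].
Proof.
rewrite /h /affine_conj hornerZ hornerD hornerN horner_comp hornerC mulVKf //
  subrK.
by rewrite hornerD hornerZ hornerX hornerC.
Qed.

Lemma iter_affine_conj n z : h (iter n (horner g) z) = iter n (horner f) (h z).
Proof. by elim: n => //= n IHn; rewrite horner_affine_conj IHn. Qed.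

Lemma root_deriv_affine_conj z : root g^`() z = root f^`() (h z).
Proof.
rewrite !rootE /affine_conj derivZ derivB derivC subr0 deriv_comp.
rewrite derivD derivC addr0 derivZ derivX !hornerE horner_comp !hornerE.
by rewrite /= mulr1 mulrAC mulVf // mul1r.
Qed.

Let h_inj : injective h.
Proof. by move=> x y /addIr /(mulfI alpha0). Qed.

Lemma orbit_affine_conj z :
  range (fun n => iter n (horner f) (h z)) =
  h @` range (fun n => iter n (horner g) z).
Proof.
rewrite image_comp; congr (_ @` _); apply: funext => n /=.
by rewrite iter_affine_conj.
Qed.

Lemma pcf_affine_conj : pcf f <-> pcf g.
Proof.
split=> pcf_f c; last first.
  have -> : c = h (alpha^-1 * (c - gamma)).
    by rewrite /h mulrA divff // mul1r subrK.
  rewrite -root_deriv_affine_conj orbit_affine_conj => /pcf_f.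
  exact: finite_image.
rewrite root_deriv_affine_conj => /pcf_f; rewrite orbit_affine_conj.
move/(finite_preimage (in2W h_inj)); apply: sub_finite_set.
exact: preimage_image.
Qed.
End Conjugation.

Lemma finite_orbit_preperiodic (T : Type) (u : nat -> T) :
  finite_set (range u) -> exists a b, (a < b)%N /\ u a = u b.
Proof.
move=> fin; apply: contrapT => no; apply: infinite_nat.
have u_inj : injective u.
  move=> a b uab; apply: contrapT => /eqP;
    rewrite neq_ltn => /orP [lt_ab|lt_ba].
    by apply: no; exists a, b.
  by apply: no; exists b, a.
have /(_ setT) := sub_finite_set _ (finite_preimage (in2W u_inj) fin); apply.
exact: preimage_image.
Qed.

Lemma exists_root_power (K : closedFieldType) e (a : K) : (0 < e)%N ->
  exists b, b ^+ e = a.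
Proof.
move=> e_gt0; have [b] : exists b, root ('X^e - a%:P) b.
  by apply/closed_rootP; rewrite size_XnsubC // eqSS -lt0n.
by rewrite rootE !hornerE subr_eq0 => /eqP <-; exists b.
Qed.

(** The translation [gamma] moves the mean of the roots to 0, and the dilation
    [alpha] makes the leading coefficient 1. *)
Lemma monic_centred_affine_conj (K : closedFieldType) (f : {poly K}) (e : nat) :
    [pchar K] =i pred0 -> size f = e.+2 -> (0 < e)%N ->
  exists alpha gamma, let g := affine_conj alpha gamma f in
    [/\ alpha != 0, size g = e.+2, g \is monic & g`_e = 0].
Proof.
move=> /pcharf0P K0 szf e_gt0; have [r fE] := closed_field_poly_normal f.
have f0 : lead_coef f != 0 by rewrite lead_coef_eq0 -size_poly_eq0 szf.
have szr : size r = e.+1.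
  by move: szf; rewrite fE size_scale // size_prod_XsubC => -[].
have [alpha alphaE] := exists_root_power (lead_coef f)^-1 e_gt0.
have alpha0 : alpha != 0.
  apply: contraNneq f0 => alpha0; move/eqP: alphaE.
  by rewrite alpha0 expr0n gtn_eqF // eq_sym invr_eq0.
pose gamma := (\sum_(x <- r) x) / e.+1%:R.
exists alpha, gamma; pose s := [seq (x - gamma) / alpha | x <- r].
have szs : size s = e.+1 by rewrite size_map.
have -> : affine_conj alpha gamma f =
    \prod_(x <- s) ('X - x%:P) + (- (gamma / alpha))%:P.
  rewrite /affine_conj [in LHS]fE comp_polyZ rmorph_prod /= big_map scalerBr.
  rewrite -[alpha^-1 *: gamma%:P]mul_polyC -polyCM [_ * gamma]mulrC polyCN.
  congr (_ - _).
  rewrite (eq_bigr (fun x => alpha *: ('X - ((x - gamma) / alpha)%:P))).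
    rewrite scaler_prod scalerA scalerA.
    rewrite big_const_seq count_predT szr iter_mulr_1 exprS.
    by rewrite mulrACA mulVf // mul1r alphaE mulfV // !scale1r.
  move=> x _; rewrite comp_polyB comp_polyX comp_polyC scalerBr -addrA;
    congr (_ + _).
  by rewrite -mul_polyC -polyCM mulrC divfK // polyCB opprB.
have szp : size (\prod_(x <- s) ('X - x%:P)) = e.+2.
  by rewrite size_prod_XsubC szs.
have szc : (size (- (gamma / alpha))%:P < e.+2)%N.
  by rewrite (leq_ltn_trans (size_polyC_leq1 _)).
split=> //.
- by rewrite size_polyDl szp.
- rewrite monicE lead_coefDl ?szp // -monicE; exact: monic_prod_XsubC.
- rewrite coefD coefC gtn_eqF // addr0.
  have := @coefPn_prod_XsubC _ s; rewrite szs => -> //.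
  rewrite big_map -mulr_suml big_split /= sumrN big_const_seq count_predT szr.
  by rewrite iter_addr_0 -[gamma *+ _]mulr_natr divfK ?K0 // subrr mul0r oppr0.
Qed.

Lemma monic_is_poly_of_crit (K : closedFieldType)
    (iota : {rmorphism rat -> K}) e (g : {poly K}) : size g = e.+2 -> g \is
      monic ->
  exists v : 'I_e.+1 -> K, g = poly_of_crit iota v.
Proof.
move=> szg g_monic.
have K0 n : n.+1%:R != 0 :> K.
  by rewrite -(rmorph_nat iota) fmorph_eq0 pnatr_eq0.
have g_lead : g`_e.+1 = 1 by rewrite -[e.+1]/(e.+2.-1) -szg; apply/monicP.
have szg' : size g^`() = e.+1.
  apply/anti_leq/andP; split.
    by rewrite -ltnS -szg lt_size_deriv // monic_neq0.
  rewrite ltnNge; apply/negP => /leq_sizeP /(_ _ (leqnn _)) /eqP.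
  by rewrite coef_deriv g_lead (negPf (K0 e)).
have [r g'E] := closed_field_poly_normal g^`().
have lead' : lead_coef g^`() = e.+1%:R.
  by rewrite lead_coefE szg' coef_deriv g_lead.
have szr : size r = e.
  by move: szg'; rewrite g'E lead' size_scale // size_prod_XsubC => -[].
have [b bE] := @exists_root_power K e.+1 g`_0 isT.
(* As [r] has size [e], the last entry of [v] is the default value [b]. *)
pose v (i : 'I_e.+1) := nth b r i; exists v.
have critE : crit_poly v = \prod_(z <- r) ('X - z%:P).
  rewrite [in RHS](big_nth b) szr big_mkord; exact: eq_bigr.
apply/polyP => -[|j].
  by rewrite poly_of_crit_coef0 -bE /v nth_default ?szr.
apply: (mulIf (K0 j)); rewrite !mulr_natr -coef_deriv poly_of_crit_coefS
  -mulrnAl ratD_mulrn.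
by rewrite critE g'E lead' coefZ.
Qed.

(** The critical points and the root of the value at 0 are algebraic by
    [preperiodic_algebraic], and the coefficients are polynomials in them. *)
Lemma pcf_coef_algebraic (K : closedFieldType) (iota : {rmorphism rat -> K}) e
    (g : {poly K}) : (0 < e)%N -> size g = e.+2 -> g \is monic -> g`_e = 0 ->
  pcf g -> forall i, algebraicOver iota g`_i.
Proof.
move=> e_gt0 szg g_monic g_e g_pcf.
have [v gE] := monic_is_poly_of_crit iota szg g_monic.
have crit_root (i : 'I_e) : root g^`() (crit_pt v i).
  rewrite gE deriv_poly_of_crit rootE hornerZ mulf_eq0; apply/orP; right.
  by rewrite horner_prod (bigD1 i) //= !hornerE subrr mul0r.
have crit_sum : \sum_(i < e) crit_pt v i = 0.
  move/eqP: g_e; rewrite gE -[X in _`_X](prednK e_gt0) poly_of_crit_coefS.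
  rewrite crit_poly_subleading // mulrN oppr_eq0 mulf_eq0 fmorph_eq0.
  by rewrite mulf_eq0 invr_eq0 !pnatr_eq0 /= => /eqP.
move=> i; have [lt_i|le_i] := ltnP i e.+2; last first.
  by rewrite nth_default ?szg //; apply: algebraic0.
rewrite gE; have [|p _ <-] := @deg_lt_poly_of_crit _ iota _ v i;
  first by rewrite -ltnS.
apply: preperiodic_algebraic => // j; rewrite -gE.
exact: finite_orbit_preperiodic (g_pcf _ (crit_root j)).
Qed.

Lemma pcf_class_monic_centred (K : closedFieldType) e (c : moduli e.+1 K) :
    (0 < e)%N -> [pchar K] =i pred0 -> pcf_class c ->
  exists g, [/\ sval c g, size g = e.+2, g \is monic, g`_e = 0 & pcf g].
Proof.
move=> e_gt0 K0 [f1]; case: c => c [f szf cE] /=; rewrite cE.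
move=> [alpha [gamma [alpha0 ->]]] /(pcf_affine_conj gamma f alpha0) f_pcf.
have [a [b [a0 szg g_monic g_e]]] := monic_centred_affine_conj K0 szf e_gt0.
exists (affine_conj a b f); split=> //; first by exists a, b.
exact/(pcf_affine_conj b f a0).
Qed.

(** * Algebraic points over other fields come from algebraic numbers *)

(** Iterated primitive element theorem. *)
Lemma common_primitive (K : fieldType) (iota : {rmorphism rat -> K})
    (s : seq K) :
    (forall a, a \in s -> algebraicOver iota a) ->
  exists2 theta, algebraicOver iota theta &
    forall a, a \in s -> exists p, (map_poly iota p).[theta] = a.
Proof.
elim: s => [|y s IHs] s_alg; first by exists 0 => //; apply: algebraic0.
have [|x x_alg xP] := IHs.
  by move=> a a_s; apply: s_alg; rewrite inE a_s orbT.
have y_alg := s_alg y (mem_head y s).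
have [[p p0 px] [q q0 qy]] := (x_alg, y_alg).
have [n [[px' px'E] [py' py'E]]] := pchar0_PET p0 px q0 qy (pchar_num _).
exists (y *+ n - x).
  apply: algebraic_sub => //; rewrite -mulr_natr; apply: algebraic_mul => //.
  by rewrite -(rmorph_nat iota); apply: algebraic_id.
move=> a; rewrite inE => /predU1P [->|/xP [r <-]]; first by exists py'.
by exists (r \Po px'); rewrite map_comp_poly horner_comp px'E.
Qed.

(** Up to a constant, [p] splits over the algebraic numbers into linear factors,
    each dividing the minimal polynomial of its root; so [p] divides the product
    of these minimal polynomials, one of which must then vanish at [theta]. *)
Lemma algebraic_conjugate (K : fieldType) (iota : {rmorphism rat -> K}) theta :
    algebraicOver iota theta ->
  exists t : algC, forall h : {poly rat}, root (map_poly ratr h) t ->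
    root (map_poly iota h) theta.
Proof.
move=> [p p0 p_theta]; have [r pE] :=
  closed_field_poly_normal (map_poly (ratr : rat -> algC) p).
pose q (z : algC) : {poly rat} := sval (minCpolyP z).
have qP z h : root (map_poly ratr h) z = (q z %| h).
  by rewrite /q; case: (minCpolyP z) => /= ? [].
have : p %| \prod_(z <- r) q z.
  rewrite -(dvdp_map (ratr : {rmorphism rat -> algC})) pE.
  rewrite dvdpZl ?lead_coef_eq0 ?map_poly_eq0 // rmorph_prod.
  apply: (big_ind2 (fun a b => a %| b)) => // [a b c d|z _];
    first exact: dvdp_mul.
  by rewrite dvdp_XsubCl qP.
move/dvdpP => [g /(congr1 (fun h => (map_poly iota h).[theta]))].
rewrite [in RHS]rmorphM hornerM (rootP p_theta) mulr0 rmorph_prod horner_prod.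
move/eqP; rewrite prodf_seq_eq0 => /hasP [z _ /= qz]; exists z => h.
by rewrite qP => /dvdpP [u ->]; rewrite rmorphM rootM [X in _ || X]qz orbT.
Qed.

Lemma meval_subst_poly (F : fieldType) (iota : {rmorphism rat -> F}) n
    (p : 'I_n -> {poly rat}) (Q : {mpoly rat[n]}) t :
  (map_mpoly iota Q).@[fun i => (map_poly iota (p i)).[t]] =
  (map_poly iota (mmap (@polyC rat) p Q)).[t].
Proof.
rewrite /map_mpoly {1 2}/mmap !rmorph_sum /= horner_sum; apply: eq_bigr => m _.
rewrite mmap1_id mul_mpolyC mevalZ mevalX rmorphM /= map_polyC hornerM hornerC.
rewrite /mmap1 rmorph_prod horner_prod; congr (_ * _); apply: eq_bigr => i _.
by rewrite rmorphXn horner_exp.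
Qed.

(** Writing [a] as polynomials in a primitive element [theta], the point [z] is
    obtained by replacing [theta] by a conjugate among the algebraic numbers. *)
Lemma algebraic_specialization (K : fieldType) (iota : {rmorphism rat -> K}) n
    (a : 'I_n -> K) : (forall i, algebraicOver iota (a i)) ->
  exists z : 'I_n -> algC, forall Q : {mpoly rat[n]},
    (map_mpoly ratr Q).@[z] = 0 -> (map_mpoly iota Q).@[a] = 0.
Proof.
move=> a_alg; have [|theta theta_alg thetaP] :=
  @common_primitive K iota (codom a).
  by move=> _ /codomP [i ->].
have [p pE] := choice (fun i => thetaP (a i) (codom_f a i)).
have [t tP] := algebraic_conjugate theta_alg.
exists (fun i => (map_poly ratr (p i)).[t]) => Q.
rewrite meval_subst_poly => /eqP /tP /eqP.
rewrite -meval_subst_poly => <-; apply: meval_eq => i.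
by rewrite pE.
Qed.

(** * The closed point of the moduli space defined by an algebraic point *)
Section PointVariety.
Variables (d : nat) (z : {ffun 'I_d.-1 -> algC}).

Definition point_eval (P : coord_ring d) : algC :=
  (map_mpoly ratr (coord_val P)).@[z].

Lemma point_eval_zmod : zmod_morphism point_eval.
Proof. by move=> P Q; rewrite /point_eval !rmorphB. Qed.
Lemma point_eval_monoid : monoid_morphism point_eval.
Proof. by split=> [|P Q]; rewrite /point_eval ?rmorph1 ?rmorphM. Qed.
HB.instance Definition _ :=
  GRing.isZmodMorphism.Build (coord_ring d) algC point_eval point_eval_zmod.
HB.instance Definition _ :=
  GRing.isMonoidMorphism.Build (coord_ring d) algC point_eval point_eval_monoid.

Definition point_ideal : {pred coord_ring d} := fun P => point_eval P == 0.

Lemma point_idealE P : (P \in point_ideal) = (point_eval P == 0).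
Proof. by []. Qed.

Lemma point_ideal_closed : idealr_closed point_ideal.
Proof.
split=> [||P Q R]; rewrite ?point_idealE ?rmorph0 ?rmorph1 ?oner_eq0 //.
by move=> /eqP Q0 /eqP R0; rewrite rmorphD rmorphM /= Q0 R0 mulr0 addr0.
Qed.

Lemma point_ideal_prime : prime_idealr_closed point_ideal.
Proof. by move=> P Q; rewrite !point_idealE rmorphM mulf_eq0. Qed.

Lemma point_ideal_radical (P : coord_ring d) n :
  P ^+ n \in point_ideal -> P \in point_ideal.
Proof. by rewrite !point_idealE rmorphXn expf_eq0 => /andP []. Qed.

Definition point_variety : subvariety d :=
  Subvariety point_ideal_closed point_ideal_radical.

Lemma coord_const_invariant (c : rat) : c%:MP \in root1_invariant d.
Proof.
by apply/asboolP => zeta _; rewrite map_mpolyC comp_mpolyC.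
Qed.

Definition coord_const (c : rat) : coord_ring d :=
  CoordRing (coord_const_invariant c).

Lemma coord_const_zmod : zmod_morphism coord_const.
Proof. by move=> a b; apply/val_inj; rewrite /= mpolyCB. Qed.
Lemma coord_const_monoid : monoid_morphism coord_const.
Proof. by split=> [|a b]; apply/val_inj; rewrite /= ?mpolyCM. Qed.
HB.instance Definition _ :=
  GRing.isZmodMorphism.Build rat (coord_ring d) coord_const coord_const_zmod.
HB.instance Definition _ :=
  GRing.isMonoidMorphism.Build rat (coord_ring d) coord_const
    coord_const_monoid.

Lemma point_eval_horner (h : {poly rat}) (P : coord_ring d) :
  point_eval (map_poly coord_const h).[P] = (map_poly ratr h).[point_eval P].
Proof.
rewrite -horner_map -map_poly_comp; congr (_.[_]); apply: eq_map_poly => c /=.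
by rewrite /point_eval map_mpolyC mevalC.
Qed.

(** The value of [P] is algebraic, so if it is nonzero it is a root of some
    rational [m] with nonzero constant term. Then [m] evaluated at [P] is in the
    ideal of the point, and its constant term, a unit, is in the ideal
    generated by [P] and the ideal of the point. *)
Lemma point_ideal_maximal (J : {pred coord_ring d}) (P : coord_ring d) :
    idealr_closed J -> {subset point_ideal <= J} -> P \in J ->
  P \in point_ideal.
Proof.
move=> [J0 J1 JP] IJ PJ; apply: contraT => P_I.
have u0 : point_eval P != 0 by rewrite -point_idealE.
have [m mu m0] : exists2 m, root (map_poly ratr m) (point_eval P) & m`_0 != 0.
  have [p [pE p_monic] _] := minCpolyP (point_eval P).
  have := root_minCpoly (point_eval P); rewrite pE.
  (* Dividing the minimal polynomial by its power of ['X] ensures that the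
     constant term is nonzero. *)
  have [k [h]] := multiplicity_XsubC p 0; rewrite monic_neq0 //= => h0 ->.
  rewrite rmorphM rmorphXn /= map_polyXsubC rmorph0 rootM => /orP [hu|].
    by exists h => //; rewrite -horner_coef0.
  by rewrite rootE horner_exp hornerXsubC subr0 expf_eq0 (negPf u0) andbF.
pose r := \poly_(i < (size m).-1) m`_i.+1.
have mE : m = r * 'X + (m`_0)%:P.
  apply/polyP => -[|i]; rewrite coefD coefMX coefC /= ?add0r // addr0 coef_poly.
  case: ltnP => // le_i; rewrite nth_default //.
  by apply: leq_trans (leqSpred _) _.
pose Q := (map_poly coord_const m).[P].
have QJ : Q \in J.
  by apply: IJ; rewrite point_idealE point_eval_horner -rootE.
have QE : Q = (map_poly coord_const r).[P] * P + coord_const m`_0.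
  by rewrite /Q {1}mE rmorphD rmorphM /= map_polyX map_polyC !hornerE.
have cJ : coord_const m`_0 \in J.
  have -> : coord_const m`_0 = - (map_poly coord_const r).[P] * P + Q by
    rewrite QE mulNr addKr.
  exact: JP.
case/negP: J1; have -> : 1 = coord_const (m`_0)^-1 * coord_const m`_0 + 0.
  by rewrite addr0 -rmorphM mulVf // rmorph1.
exact: JP.
Qed.

Lemma point_variety_dim0 : has_dim point_variety 0.
Proof.
split.
  exists (fun=> point_ideal); split=> // i _; split=> //; split.
    exact: point_ideal_closed.
  exact: point_ideal_prime.
move=> [p [pP p_strict]]; have [_] := p_strict 0%N isT; apply=> P Pp.
have [_ I0] := pP 0%N isT; have [[p1_ideal _] I1] := pP 1%N isT.
exact/I0/(point_ideal_maximal p1_ideal I1 Pp).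
Qed.
End PointVariety.

Theorem corollary3 (d : nat) (hd : (2 <= d)%N) :
  (exists V : nat -> subvariety d,
     (forall n : nat, has_dim (V n) 0) /\
     (forall K : closedFieldType, [pchar K] =i pred0 ->
        forall c : moduli d K, pcf_class c ->
          exists n : nat, on_subvariety (V n) c)) /\
  (forall (R : realType) (c : moduli d (complex R)),
     pcf_class c -> defined_over_Qbar c).
Proof.
case: d hd => // e e_gt0.
have algebraic (K : closedFieldType) (iota : {rmorphism rat -> K})
    (c : moduli e.+1 K) : pcf_class c ->
    exists g, [/\ sval c g, g \is monic, g`_e = 0 &
      forall i, algebraicOver iota g`_i].
  move=> c_pcf; have K0 : [pchar K] =i pred0.
    by move=> p; rewrite (fmorph_pchar iota) pchar_num.
  have [g [cg szg g_monic g_e g_pcf]] := pcf_class_monic_centred e_gt0 K0 c_pcf.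
  exists g; split=> //.
  exact: (pcf_coef_algebraic iota e_gt0 szg g_monic g_e g_pcf).
split.
  pose pt n : {ffun 'I_e.+1.-1 -> algC} := odflt [ffun=> 0] (unpickle n).
  exists (fun n => point_variety (pt n)); split=> [n|K K0 c c_pcf].
    exact: point_variety_dim0.
  have [iota iotaE] := ratr_morphism K0.
  have [g [cg g_monic g_e g_alg]] := algebraic K iota c c_pcf.
  have [z zP] := algebraic_specialization (fun i : 'I_e.+1.-1 => g_alg i).
  exists (pickle (finfun z)), g; split=> // P.
  rewrite /= /pt pickleK /= point_idealE -iotaE => /eqP P0; apply: zP.
  by rewrite -P0; apply: meval_eq => i; rewrite ffunE.
move=> R c c_pcf.
have [iota iotaE] := @ratr_morphism (complex R) (pchar_num _).
have [g [cg _ _ g_alg]] := algebraic _ iota c c_pcf.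
by exists g => // i; rewrite -iotaE.
Qed.
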